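(* Let $\mathfrak{g}$ be a finite-dimensional real Lie algebra, $B$ a projective limit of real Banach algebras of polynomial growth, and $\gamma\colon\mathfrak{g}\to B$ a homomorphism of real Lie algebras ($B$ being a Lie algebra under the commutator). If $\gamma$ is injective, then $\mathfrak{g}$ is triangular.
   Context: Associative algebras have an identity and homomorphisms preserve identities. A finite-dimensional real Lie algebra $\mathfrak{g}$ is triangular if it is soluble (solvable) and for every $x\in\mathfrak{g}$ all eigenvalues of $\operatorname{ad}x$ lie in $\mathbb{R}$. An element $b$ of a complex Banach algebra is of polynomial growth if there are $K>0$ and $\alpha\ge 0$ with $\|e^{isb}\|\le K(1+|s|)^\alpha$ for all $s\in\mathbb{R}$; an element of a real Banach algebra is of polynomial growth if it is so in the complexification. A real Banach algebra is of polynomial growth if all its elements are of polynomial growth. *)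

(* Defs.v *)
From HB Require Import structures.
From mathcomp Require Import all_boot all_order all_algebra.
From mathcomp Require Import complex ring lra.
From mathcomp Require Import all_classical all_reals all_analysis.

Set Implicit Arguments.
Unset Strict Implicit.
Unset Printing Implicit Defensive.

Import Order.TTheory GRing.Theory Num.Theory.
Import numFieldNormedType.Exports.

Local Open Scope classical_set_scope.
Local Open Scope ring_scope.

HB.mixin Record hasLieBracket (K : fieldType) L of Vector K L := {
  lie : L -> L -> L;
  lieDl : forall x y z, lie (x + y) z = lie x z + lie y z;
  lieZl : forall (a : K) x y, lie (a *: x) y = a *: lie x y;
  lieDr : forall x y z, lie x (y + z) = lie x y + lie x z;
  lieZr : forall (a : K) x y, lie x (a *: y) = a *: lie x y;
  liexx : forall x, lie x x = 0;
  lie_jacobi : forall x y z,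
    lie x (lie y z) + lie y (lie z x) + lie z (lie x y) = 0
}.

#[short(type="finLieAlgType")]
HB.structure Definition FinLieAlgebra (K : fieldType) :=
  {L of Vector K L & hasLieBracket K L}.

Section LieTheory.
Variables (K : fieldType) (g : finLieAlgType K).

Lemma lie_linear (x : g) : linear (lie x).
Proof. by move=> a y z; rewrite lieDr lieZr. Qed.

HB.instance Definition _ (x : g) :=
  GRing.isLinear.Build K g g *:%R (lie x) (lie_linear x).

Definition ad (x : g) : 'End(g) := linfun (lie x).

(* As the bracket is bilinear, the brackets of basis vectors of U and V span
   the linear span of all [u, v] with u in U and v in V. *)
Definition lie_prod (U V : {vspace g}) : {vspace g} :=
  <<[seq lie u v | u <- vbasis U, v <- vbasis V]>>%VS.

Fixpoint derived_series (n : nat) : {vspace g} :=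
  if n is m.+1 then lie_prod (derived_series m) (derived_series m)
  else fullv.

Definition lie_solvable : Prop := exists n, derived_series n = 0%VS.

End LieTheory.

Arguments lie_solvable {K} g.

Section Triangular.
Variables (R : realType) (g : finLieAlgType R).

(* Eigenvalues are taken in C: those of the complexified matrix of ad x. *)
Definition ad_eigenvalue (x : g) (z : R[i]) : Prop :=
  eigenvalue (map_mx (real_complex R)
    (passmx.mxof (vbasis {:g}) (vbasis {:g}) (ad x))) z.

Definition triangular : Prop :=
  lie_solvable g /\
  forall (x : g) (z : R[i]), ad_eigenvalue x z -> exists r : R, z = r%:C%C.

End Triangular.

Arguments triangular {R} g.

(* Unital associative algebras. The product is not MathComp's ring product: the
   hierarchy has no structure joining rings and normed modules over a base field
   other than the carrier itself. The zero algebra is allowed. *)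

HB.mixin Record hasAlgebraMul (K : pzRingType) A of GRing.Lmodule K A := {
  amul : A -> A -> A;
  aone : A;
  amulA : associative amul;
  amul1l : left_id aone amul;
  amul1r : right_id aone amul;
  amulDl : left_distributive amul +%R;
  amulDr : right_distributive amul +%R;
  amulZl : forall (a : K) x y, amul (a *: x) y = a *: amul x y;
  amulZr : forall (a : K) x y, amul x (a *: y) = a *: amul x y
}.

#[short(type="unitalAlgType")]
HB.structure Definition UnitalAlgebra (K : pzRingType) :=
  {A of GRing.Lmodule K A & hasAlgebraMul K A}.

Reserved Notation "x ** y" (at level 40, left associativity).
Notation "x ** y" := (amul x y) : ring_scope.

Definition apow (K : pzRingType) (A : unitalAlgType K) (x : A) (n : nat) : A :=
  iter n (amul x) aone.

Definition commutator (K : pzRingType) (A : unitalAlgType K) (x y : A) : A :=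
  x ** y - y ** x.

Definition alg_hom (K : pzRingType) (A B : unitalAlgType K) (f : A -> B) :=
  [/\ linear f, {morph f : x y / x ** y} & f aone = aone].

#[short(type="topUnitalAlgType")]
HB.structure Definition TopUnitalAlgebra (K : numDomainType) :=
  {A of UnitalAlgebra K A & PreTopologicalLmodule K A}.

HB.mixin Record isSubmultiplicative (K : numFieldType) A
    of UnitalAlgebra K A & CompleteNormedModule K A := {
  normr_amul : forall x y : A, `|x ** y| <= `|x| * `|y|
}.

#[short(type="banachAlgType")]
HB.structure Definition BanachAlgebra (K : numFieldType) :=
  {A of UnitalAlgebra K A & CompleteNormedModule K A
      & isSubmultiplicative K A}.

(* The pair (a, b) stands for a + i b. *)
Definition complexification (A : Type) : Type := (A * A)%type.

Section ComplexificationAlgebra.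
Variables (R : realType) (A : unitalAlgType R).
Local Notation AC := (complexification A).
Local Notation Re := complex.Re.
Local Notation Im := complex.Im.
Implicit Types (x y z : AC) (c d : R[i]).

HB.instance Definition _ := GRing.Zmodule.on AC.

Definition cplx_one : AC := (aone, 0).

Definition cplx_mul x y : AC :=
  (x.1 ** y.1 - x.2 ** y.2, x.1 ** y.2 + x.2 ** y.1).

Definition cplx_scale c x : AC :=
  (Re c *: x.1 - Im c *: x.2, Re c *: x.2 + Im c *: x.1).

Lemma cplx_ext x y : x.1 = y.1 -> x.2 = y.2 -> x = y.
Proof. by case: x y => [? ?] [? ?] /= -> ->. Qed.

Lemma amul0l (a : A) : 0 ** a = 0.
Proof. by rewrite -(scale0r (0 : A)) amulZl !scale0r. Qed.

Lemma amul0r (a : A) : a ** 0 = 0.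
Proof. by rewrite -(scale0r (0 : A)) amulZr !scale0r. Qed.

Lemma amulNl (a b : A) : (- a) ** b = - (a ** b).
Proof. by rewrite -scaleN1r amulZl scaleN1r. Qed.

Lemma amulNr (a b : A) : a ** (- b) = - (a ** b).
Proof. by rewrite -scaleN1r amulZr scaleN1r. Qed.

Local Notation expand :=
  (amulDl, amulDr, amulNl, amulNr, amulZl, amulZr, amulA,
   scalerDl, scalerDr, scalerBl, scalerBr, scalerN, scaleNr, scalerA, opprD,
   opprK).

Lemma cplx_mulA : associative cplx_mul.
Proof.
move=> x y z; apply: cplx_ext; rewrite /= !expand -!addrA;
  by congr (_ + _); rewrite [RHS]addrC -addrA.
Qed.

Lemma cplx_mul1x : left_id cplx_one cplx_mul.
Proof.
by move=> x; apply: cplx_ext; rewrite /= !amul1l amul0l ?subr0 ?addr0.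
Qed.

Lemma cplx_mulx1 : right_id cplx_one cplx_mul.
Proof.
by move=> x; apply: cplx_ext; rewrite /= !amul1r amul0r ?subr0 ?add0r.
Qed.

Lemma cplx_mulDl : left_distributive cplx_mul +%R.
Proof.
by move=> x y z; apply: cplx_ext; rewrite /= !expand addrACA.
Qed.

Lemma cplx_mulDr : right_distributive cplx_mul +%R.
Proof.
by move=> x y z; apply: cplx_ext; rewrite /= !expand addrACA.
Qed.

Lemma cplx_scaleA c d x :
  cplx_scale c (cplx_scale d x) = cplx_scale (c * d) x.
Proof.
case: c d => [a b] [c d]; apply: cplx_ext; rewrite /= !expand -!addrA;
  by congr (_ + _); rewrite [RHS]addrC -addrA.
Qed.

Lemma cplx_scale1 : left_id 1 cplx_scale.
Proof.
by move=> x; apply: cplx_ext; rewrite /= !scale1r scale0r ?subr0 ?addr0.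
Qed.

Lemma cplx_scaleDr : right_distributive cplx_scale +%R.
Proof. by move=> c x y; apply: cplx_ext; rewrite /= !expand addrACA. Qed.

Lemma cplx_scaleDl x : {morph cplx_scale^~ x : c d / c + d}.
Proof.
by move=> [a b] [c d]; apply: cplx_ext; rewrite /= !expand addrACA.
Qed.

HB.instance Definition _ := GRing.Zmodule_isLmodule.Build R[i] AC
  cplx_scaleA cplx_scale1 cplx_scaleDr cplx_scaleDl.

Lemma cplx_scaleE c x :
  c *: x = (Re c *: x.1 - Im c *: x.2, Re c *: x.2 + Im c *: x.1).
Proof. by []. Qed.

Lemma cplx_mulZl c x y : cplx_mul (c *: x) y = c *: cplx_mul x y.
Proof.
rewrite !cplx_scaleE; apply: cplx_ext; rewrite /= !expand -!addrA;
  by congr (_ + _); rewrite [LHS]addrC -addrA.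
Qed.

Lemma cplx_mulZr c x y : cplx_mul x (c *: y) = c *: cplx_mul x y.
Proof.
rewrite !cplx_scaleE; apply: cplx_ext; rewrite /= !expand -!addrA;
  by congr (_ + _); rewrite addrCA.
Qed.

HB.instance Definition _ := hasAlgebraMul.Build R[i] AC
  cplx_mulA cplx_mul1x cplx_mulx1 cplx_mulDl cplx_mulDr cplx_mulZl cplx_mulZr.

End ComplexificationAlgebra.

Section ComplexificationNorm.
Variables (R : realType) (A : banachAlgType R).
Local Notation AC := (complexification A).
Local Notation Re := complex.Re.
Local Notation Im := complex.Im.
Local Notation normc := complex.ComplexField.Normc.normc.
Implicit Types (x y z : AC) (c u : R[i]).

Definition cplx_norm1 z : R := `|z.1| + `|z.2|.

(* The sum norm on A + iA is submultiplicative but not homogeneous over C; its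
   supremum over the rotations u z with |u| = 1 is both, and is equivalent to
   it, so that the topology is that of A * A. *)
Definition cplx_norm z : R :=
  sup [set cplx_norm1 (u *: z) | u in [set u : R[i] | `|u| = 1]].

Lemma cplx_norm1_ge0 z : 0 <= cplx_norm1 z.
Proof. by rewrite addr_ge0. Qed.

Lemma cplx_norm1D x y : cplx_norm1 (x + y) <= cplx_norm1 x + cplx_norm1 y.
Proof. by rewrite addrACA lerD// ler_normD. Qed.

Lemma cplx_norm1M x y : cplx_norm1 (x ** y) <= cplx_norm1 x * cplx_norm1 y.
Proof.
rewrite /cplx_norm1 /=.
have := ler_normB (x.1 ** y.1) (x.2 ** y.2).
have := ler_normD (x.1 ** y.2) (x.2 ** y.1).
have := normr_amul x.1 y.1; have := normr_amul x.2 y.2.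
have := normr_amul x.1 y.2; have := normr_amul x.2 y.1.
lra.
Qed.

Lemma normcE c : `|c| = (normc c)%:C%C.
Proof. by []. Qed.

Lemma Re_le_normc c : `|Re c| <= normc c.
Proof.
by case: c => a b /=; rewrite -sqrtr_sqr ler_wsqrtr// lerDl sqr_ge0.
Qed.

Lemma Im_le_normc c : `|Im c| <= normc c.
Proof.
by case: c => a b /=; rewrite -sqrtr_sqr ler_wsqrtr// lerDr sqr_ge0.
Qed.

Lemma normc_unit u : `|u| = 1 -> normc u = 1.
Proof. by rewrite normcE => -[]. Qed.

Lemma cplx_norm1Z c z : cplx_norm1 (c *: z) <= normc c *+ 2 * cplx_norm1 z.
Proof.
rewrite cplx_scaleE /cplx_norm1 /=.
have lec (a : A) : `|Re c *: a| <= normc c * `|a|.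
  by rewrite normrZ ler_wpM2r// Re_le_normc.
have lec' (a : A) : `|Im c *: a| <= normc c * `|a|.
  by rewrite normrZ ler_wpM2r// Im_le_normc.
have := ler_normB (Re c *: z.1) (Im c *: z.2).
have := ler_normD (Re c *: z.2) (Im c *: z.1).
have := lec z.1; have := lec z.2; have := lec' z.1; have := lec' z.2.
rewrite mulr2n; lra.
Qed.

Lemma cplx_norm1_real (r : R) z :
  0 <= r -> cplx_norm1 (r%:C%C *: z) = r * cplx_norm1 z.
Proof.
move=> r0; rewrite cplx_scaleE /cplx_norm1 /= !scale0r subr0 addr0.
by rewrite !normrZ ger0_norm// mulrDr.
Qed.

Lemma cplx_norm_has_sup z :
  has_sup [set cplx_norm1 (u *: z) | u in [set u : R[i] | `|u| = 1]].
Proof.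
split; first by exists (cplx_norm1 (1 *: z)), 1 => //=; rewrite normr1.
exists (2 * cplx_norm1 z) => _ [u /= /normc_unit u1 <-].
by apply: le_trans (cplx_norm1Z u z) _; rewrite u1.
Qed.

Lemma cplx_norm_ge u z : `|u| = 1 -> cplx_norm1 (u *: z) <= cplx_norm z.
Proof.
by move=> u1; apply: sup_upper_bound (cplx_norm_has_sup z) _ _; exists u.
Qed.

Lemma cplx_norm_le z (M : R) :
  (forall u, `|u| = 1 -> cplx_norm1 (u *: z) <= M) -> cplx_norm z <= M.
Proof.
move=> zM; apply: ge_sup; first by case: (cplx_norm_has_sup z).
by move=> _ [u /= u1 <-]; exact: zM.
Qed.

Lemma cplx_norm1_le z : cplx_norm1 z <= cplx_norm z.
Proof. by rewrite -{1}(scale1r z) cplx_norm_ge// normr1. Qed.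

Lemma cplx_norm_le1 z : cplx_norm z <= 2 * cplx_norm1 z.
Proof.
apply: cplx_norm_le => u /normc_unit u1.
by apply: le_trans (cplx_norm1Z u z) _; rewrite u1.
Qed.

Lemma cplx_normD x y : cplx_norm (x + y) <= cplx_norm x + cplx_norm y.
Proof.
apply: cplx_norm_le => u u1; rewrite scalerDr.
by apply: le_trans (cplx_norm1D _ _) _; rewrite lerD ?cplx_norm_ge.
Qed.

Lemma cplx_normM x y : cplx_norm (x ** y) <= cplx_norm x * cplx_norm y.
Proof.
apply: cplx_norm_le => u u1; rewrite -amulZl.
apply: le_trans (cplx_norm1M _ _) _.
by rewrite ler_pM ?cplx_norm1_ge0 ?cplx_norm_ge ?cplx_norm1_le.
Qed.

Let cplx_normZ_le c z : cplx_norm (c *: z) <= normc c * cplx_norm z.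
Proof.
have [->|c0] := eqVneq c 0.
  rewrite scale0r complex.ComplexField.Normc.normc0 mul0r.
  apply: cplx_norm_le => u _; rewrite scaler0 /cplx_norm1 /=.
  by rewrite normr0 addr0.
have n0 : `|c| != 0 by rewrite normr_eq0.
have nc_ge0 : 0 <= normc c by apply: le_trans (Re_le_normc c).
apply: cplx_norm_le => u u1.
have -> : u *: (c *: z) = (normc c)%:C%C *: ((u * (c / `|c|)) *: z).
  by rewrite !scalerA -normcE; congr (_ *: _); field.
rewrite cplx_norm1_real// ler_wpM2l// cplx_norm_ge//.
by rewrite normrM u1 mul1r normrM normfV normr_id divff.
Qed.

Lemma cplx_normZ c z : cplx_norm (c *: z) = normc c * cplx_norm z.
Proof.
apply/eqP; rewrite eq_le cplx_normZ_le /=.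
have [->|c0] := eqVneq c 0.
  rewrite complex.ComplexField.Normc.normc0 mul0r.
  by apply: le_trans (cplx_norm1_le _); exact: cplx_norm1_ge0.
have nc0 : 0 < normc c.
  by rewrite -ltcR -normcE normr_gt0.
rewrite -ler_pdivlMl// -complex.ComplexField.Normc.normcV.
by apply: le_trans (cplx_normZ_le _ _); rewrite scalerA mulVf// scale1r.
Qed.

Lemma cplx_norm_eq0 z : cplx_norm z = 0 -> z = 0.
Proof.
move=> z0; have := cplx_norm1_le z; rewrite z0 => z1.
have := cplx_norm1_ge0 z; rewrite /cplx_norm1 => z2.
have {z1 z2} /eqP : `|z.1| + `|z.2| = 0 by apply/eqP; rewrite eq_le z2 andbT.
rewrite paddr_eq0// !normr_eq0 => /andP[/eqP z1 /eqP z2].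
exact: cplx_ext.
Qed.

Let normC z : R[i] := (cplx_norm z)%:C%C.

Let normCD x y : normC (x + y) <= normC x + normC y.
Proof. by rewrite /normC -rmorphD lecR cplx_normD. Qed.

Let normCZ c x : normC (c *: x) = `|c| * normC x.
Proof. by rewrite /normC cplx_normZ normcE rmorphM. Qed.

Let normC_eq0 x : normC x = 0 -> x = 0.
Proof. by move=> [] /cplx_norm_eq0. Qed.

HB.instance Definition _ :=
  Lmodule_isNormed.Build R[i] AC normCD normCZ normC_eq0.

Lemma cplx_normE z : `|z| = (cplx_norm z)%:C%C.
Proof. by []. Qed.

Let cplx_normCM (z1 z2 : AC) : `|z1 ** z2| <= `|z1| * `|z2|.
Proof. by rewrite !cplx_normE -rmorphM lecR cplx_normM. Qed.

Lemma cplx_complete (F : set_system AC) :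
  ProperFilter F -> cauchy F -> cvg F.
Proof.
move=> FF Fc.
have Fball (e : R) : 0 < e -> exists w, F [set z | cplx_norm (w - z) < e].
  move=> e0; have e0' : 0 < e%:C%C :> R[i] by rewrite ltcR.
  have [w Fw] := (cauchyP F).1 Fc _ e0'.
  exists w; apply: filterS Fw => z; rewrite -ball_normE /= cplx_normE ltcR.
  by [].
have cvg_proj (p : AC -> A) : (forall w z, `|p w - p z| <= cplx_norm1 (w - z)) ->
    cvg (p @ F).
  move=> p_le; apply: cauchy_cvg; apply: cauchy_exP => e /Fball[w Fw].
  exists (p w); change (F (p @^-1` ball (p w) e)).
  apply: filterS Fw => z /= wz; rewrite -ball_normE /=.
  apply: le_lt_trans (p_le _ _) _.
  exact: le_lt_trans (cplx_norm1_le _) wz.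
have /cvg_ex[/= a Fa] : cvg ((fun z : AC => z.1) @ F).
  by apply: cvg_proj => w z; rewrite /cplx_norm1 /= lerDl.
have /cvg_ex[/= b Fb] : cvg ((fun z : AC => z.2) @ F).
  by apply: cvg_proj => w z; rewrite /cplx_norm1 /= lerDr.
apply/cvg_ex; exists ((a, b) : AC).
apply/fcvgrPdist_lt => /= e; rewrite ltcE /= => /andP[/eqP Ime e0].
have -> : e = (Re e)%:C%C by case: e Ime {e0} => r i /= ->.
have e4 : 0 < Re e / 4%:R by rewrite divr_gt0.
have /cvgrPdist_lt/(_ _ e4) := Fa; have /cvgrPdist_lt/(_ _ e4) := Fb.
move=> Fb4 Fa4; near=> z; rewrite cplx_normE ltcR.
apply: le_lt_trans (cplx_norm_le1 _) _; rewrite /cplx_norm1 /=.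
have : `|a - z.1| < Re e / 4%:R by near: z.
have : `|b - z.2| < Re e / 4%:R by near: z.
lra.
Unshelve. all: by end_near. Qed.

HB.instance Definition _ := Uniform_isComplete.Build AC cplx_complete.

HB.instance Definition _ := isSubmultiplicative.Build R[i] AC cplx_normCM.

End ComplexificationNorm.

Definition aexp (K : numFieldType) (A : banachAlgType K) (x : A) : A :=
  limn (series (fun n => (n`!%:R)^-1 *: apow x n)).

Section PolynomialGrowth.
Variable R : realType.

Definition poly_growth (A : banachAlgType R[i]) (b : A) : Prop :=
  exists K alpha : R, [/\ 0 < K, 0 <= alpha &
    forall s : R,
      `|aexp ((s *i)%C *: b)| <= (K * (1 + `|s|) `^ alpha)%:C%C].

Definition real_poly_growth (A : banachAlgType R) (b : A) : Prop :=
  poly_growth ((b, 0) : complexification A).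

Definition of_poly_growth (A : banachAlgType R) : Prop :=
  forall b : A, real_poly_growth b.

End PolynomialGrowth.

Record projective_system (R : realType) := ProjectiveSystem {
  ps_index : Type;
  ps_le : ps_index -> ps_index -> Prop;
  ps_obj : ps_index -> banachAlgType R;
  ps_map : forall i j, ps_le i j -> ps_obj j -> ps_obj i;
  ps_inhabited : inhabited ps_index;
  ps_le_refl : forall i, ps_le i i;
  ps_le_trans : forall i j k, ps_le i j -> ps_le j k -> ps_le i k;
  ps_le_directed : forall i j, exists k, ps_le i k /\ ps_le j k;
  ps_map_hom : forall i j (ij : ps_le i j), alg_hom (ps_map ij);
  ps_map_continuous : forall i j (ij : ps_le i j), continuous (ps_map ij);
  ps_map_id : forall i (ii : ps_le i i) x, ps_map ii x = x;
  ps_map_comp : forall i j k (ij : ps_le i j) (jk : ps_le j k)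
    (ik : ps_le i k) x, ps_map ij (ps_map jk x) = ps_map ik x
}.

(* B, with the projections p i, is the algebra of threads of S endowed with the
   initial topology; as S is directed, the preimages of neighbourhoods by single
   projections form a basis of neighbourhoods. *)
Record is_projective_limit (R : realType) (S : projective_system R)
    (B : topUnitalAlgType R) (p : forall i : ps_index S, B -> ps_obj i) : Prop := {
  pl_hom : forall i, alg_hom (p i);
  pl_compat : forall i j (ij : ps_le i j) b, ps_map ij (p j b) = p i b;
  pl_thread : forall x : forall i : ps_index S, ps_obj i,
    (forall i j (ij : ps_le i j), ps_map ij (x j) = x i) ->
    exists! b, forall i, p i b = x i;
  pl_nbhs : forall (b : B) (V : set B), nbhs b V <->
    exists i, exists2 W, nbhs (p i b) W & p i @^-1` W `<=` V
}.

Definition lie_hom (R : realType) (g : finLieAlgType R) (B : unitalAlgType R)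
    (f : g -> B) : Prop :=
  linear f /\ forall x y, f (lie x y) = commutator (f x) (f y).

(* Main.v *)
Require Import Defs.
From HB Require Import structures.
From mathcomp Require Import all_boot all_order all_algebra.
From mathcomp Require Import complex ring lra.
From mathcomp Require Import all_classical all_reals all_analysis.

(* Separation of points by the projections, directedness and finite dimension
   make some p i \o gamma injective, so g embeds in a single Banach algebra A of
   polynomial growth.

   Real eigenvalues: suppose [b, y] = (p + iq) y in the complexification of A,
   with b in A and y <> 0. Then b' := b + p is also in A, and b y - y b' = iq y,
   so e^{isb} y e^{-isb'} = e^{-sq} y. The left-hand side grows polynomially in
   s, hence q = 0.

   Solvability: as all ad x have real spectrum, the Killing form is positive
   semidefinite and its isotropic vectors are ad-nilpotent. Since ad x is skew
   for this form, [g, g] is isotropic, and Engel's theorem applies to it. *)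

Set Implicit Arguments.
Unset Strict Implicit.
Unset Printing Implicit Defensive.

Import Order.TTheory GRing.Theory Num.Theory passmx.
Import numFieldNormedType.Exports.
Local Open Scope classical_set_scope.
Local Open Scope ring_scope.

(** * Engel's theorem *)

Section Engel.
Variables (K : fieldType) (g : finLieAlgType K).
Implicit Types (x y z u v : g) (U V W k n : {vspace g}).

Lemma lie0r x : lie x 0 = 0.
Proof. by rewrite -(scale0r 0) lieZr !scale0r. Qed.

Lemma lie0l x : lie 0 x = 0.
Proof. by rewrite -(scale0r 0) lieZl !scale0r. Qed.

Lemma lieNr x y : lie x (- y) = - lie x y.
Proof. by rewrite -scaleN1r lieZr scaleN1r. Qed.

Lemma lieC x y : lie x y = - lie y x.
Proof.
apply/eqP; rewrite -addr_eq0; have /eqP := liexx (x + y).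
by rewrite lieDl !lieDr !liexx add0r addr0.
Qed.

Lemma lie_leibniz x y z : lie x (lie y z) = lie (lie x y) z + lie y (lie x z).
Proof.
have /eqP := lie_jacobi x y z; rewrite -addrA addr_eq0 => /eqP ->.
by rewrite opprD -(lieC (lie x y)) (lieC z x) lieNr opprK addrC.
Qed.

Lemma adE x y : ad x y = lie x y.
Proof. by rewrite lfunE. Qed.

Lemma lie_prodP U V W :
  reflect {in U & V, forall u v, lie u v \in W} (lie_prod U V <= W)%VS.
Proof.
apply: (iffP idP) => [UVW u v uU vV|UVW]; last first.
  apply/span_subvP => _ /allpairsP[[u v] /= [uU vV ->]].
  by apply: UVW; apply: vbasis_mem.
apply: (subvP UVW).
(* Linearity is declared for [lie x] only, so the left argument is expanded after a swap by
   [lieC]. *)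
rewrite (coord_vbasis uU) (coord_vbasis vV) linear_sum memv_suml// => j _.
rewrite linearZ memvZ//= lieC memvN linear_sum memv_suml// => i _.
rewrite linearZ memvZ//= lieC memvN memv_span//.
by apply: allpairs_f; apply: mem_nth; rewrite size_tuple.
Qed.

Definition lie_stable k V := {in k & V, forall x v, lie x v \in V}.

Definition ad_nilpotent x := exists m, forall y, iter m (lie x) y = 0.

(* Engel's theorem for the subquotients V/W of the adjoint module, without
   forming quotients: k kills a nonzero vector of V/W. *)
Definition engel k := forall W V, (W <= V)%VS -> ~~ (V <= W)%VS ->
  lie_stable k W -> lie_stable k V ->
  exists2 v, v \in V & v \notin W /\ forall x, x \in k -> lie x v \in W.

(** Applied to n/k, [engel k] yields x in n outside k with [k, x] inside k; take k' = k + <x>. The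
    vectors of V/W killed by k form a nonzero space, stable under x because x normalises k, and the
    nilpotent ad x kills a nonzero vector of it. *)
Lemma engel_step k n : (forall x, x \in n -> ad_nilpotent x) ->
  (k <= n)%VS -> ~~ (n <= k)%VS -> lie_stable k k -> lie_stable n n ->
  engel k ->
  exists k', [/\ (k' <= n)%VS, \dim k' = (\dim k).+1, lie_stable k' k' &
    engel k'].
Proof.
move=> nil kn nk kk nn ek.
have kSn : lie_stable k n by move=> x v /(subvP kn); apply: nn.
have [x xn [xk kx]] := ek k n kn nk kk kSn.
have xkk y : y \in k -> lie x y \in k by move=> yk; rewrite lieC memvN kx.
exists (k + <[x]>)%VS; split.
- by rewrite subv_add kn -memvE.
- rewrite dimv_disjoint_sum; last first.
    apply/eqP; rewrite -subv0; apply/subvP => y; rewrite memv_cap => /andP[yk].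
    move=> /vlineP[a ya]; rewrite memv0 ya; have [->|a0] := eqVneq a 0.
      by rewrite scale0r.
    by case/negP: xk; rewrite -(scalerK a0 x) memvZ -?ya.
  rewrite dim_vline; case: eqP xk => [->|_ _]; last by rewrite addn1.
  by rewrite mem0v.
- move=> u v /memv_addP[y yk [_ /vlineP[a ->] ->]]
    /memv_addP[z zk [_ /vlineP[b ->] ->]].
  apply: (subvP (addvSl _ _)).
  rewrite !(lieDl, lieDr, lieZl, lieZr) liexx !scaler0 addr0.
  apply: memvD (memvZ _ (xkk z zk)).
  by apply: memvD (memvZ _ (kx y yk)); exact: kk.
move=> W V WV VW kW kV.
have ink y : y \in k -> y \in (k + <[x]>)%VS by apply/subvP/addvSl.
have inx : x \in (k + <[x]>)%VS by apply/(subvP (addvSr _ _))/memv_line.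
have [v0 v0V [v0W kv0]] := ek W V WV VW
  (fun y w yk => kW y w (ink y yk)) (fun y w yk => kV y w (ink y yk)).
have xV m : iter m (lie x) v0 \in V by elim: m => //= m IH; rewrite kV.
have kxW m y : y \in k -> lie y (iter m (lie x) v0) \in W.
  elim: m y => [|m IH] y yk /=; first exact: kv0.
  by rewrite lie_leibniz memvD ?IH ?kx// kW// IH.
have [N xN] := nil x xn.
have exW : exists m, iter m (lie x) v0 \in W by exists N; rewrite xN mem0v.
(* The last iterate of [v0] under ad x outside W is killed by x modulo W. The least exponent landing
   in W is positive since [v0] is not in W. *)
case: (ex_minnP exW) => -[|m] mW mmin; first by rewrite mW in v0W.
exists (iter m (lie x) v0) => //; split.
  by apply/negP => /mmin; rewrite ltnn.
move=> _ /memv_addP[y yk [_ /vlineP[a ->] ->]].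
by rewrite lieDl lieZl memvD ?memvZ// kxW.
Qed.

(** Starting from the zero subalgebra, [engel_step] raises the dimension by one until n is
    reached. *)
Lemma engel_theorem n : (forall x, x \in n -> ad_nilpotent x) ->
  lie_stable n n -> engel n.
Proof.
move=> nil nn.
have ex_k d : (d <= \dim n)%N ->
    exists k, [/\ (k <= n)%VS, \dim k = d, lie_stable k k & engel k].
  elim: d => [_|d IH dn].
    exists 0%VS; split; rewrite ?sub0v ?dimv0//.
      by move=> x y; rewrite !memv0 => /eqP -> _; rewrite lie0l.
    move=> W V WV /subvPn[v vV vW] _ _; exists v => //; split=> // x.
    by rewrite memv0 => /eqP ->; rewrite lie0l mem0v.
  have [k [kn dk kk ek]] := IH (ltnW dn).
  have nk : ~~ (n <= k)%VS.
    by apply/negP => /dimvS; rewrite dk leqNgt dn.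
  by have [k' []] := engel_step nil kn nk kk nn ek; rewrite dk; exists k'.
have [k [kn dk kk ek]] := ex_k _ (leqnn _).
by have /eqP <- : (k == n)%VS by rewrite -(geq_leqif (dimv_leqif_eq kn)) dk.
Qed.

(** Engel's theorem on g/V, repeated, builds a chain of subspaces up to g, each carried by n into
    the previous one. If k lies in n and in one member, [k, k] lies in n and in the previous member,
    so its derived series reaches 0; this is applied to k = [g, g]. *)
Lemma solvable_of_ad_nilpotent_derived n :
  (forall x, x \in n -> ad_nilpotent x) ->
  (forall x y, lie x y \in n) -> lie_solvable g.
Proof.
move=> nil gn.
have en : engel n by apply: engel_theorem => // x y _ _; exact: gn.
have flag d : (d <= \dim {:g})%N -> exists V, [/\ (\dim V >= d)%N,
    lie_stable n V & exists m, (forall k : {vspace g}, (k <= n)%VS ->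
     (k <= V)%VS -> iter m (fun k => lie_prod k k) k = 0%VS)].
  elim: d => [_|d IH dg].
    exists 0%VS; split=> //.
      by move=> x y _; rewrite !memv0 => /eqP ->; rewrite lie0r.
    by exists 0 => k _; rewrite subv0 => /eqP.
  have [V [dV nV [m Vm]]] := IH (ltnW dg).
  have [fV|VF] := boolP ({:g} <= V)%VS.
    exists V; split=> //; first exact: leq_trans dg (dimvS fV).
    by exists m.
  have [v _ [vV nv]] := en V fullv (subvf V) VF nV (fun _ _ _ _ => memvf _).
  exists (V + <[v]>)%VS; split.
  - apply: leq_ltn_trans dV _; rewrite ltnNge; apply/negP => dle.
    have /eqP VE : (V == V + <[v]>)%VS.
      by rewrite -(geq_leqif (dimv_leqif_eq (addvSl V <[v]>))).
    by case/negP: vV; rewrite VE; apply/(subvP (addvSr _ _))/memv_line.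
  - move=> x u xn /memv_addP[y yV [_ /vlineP[a ->] ->]].
    apply: (subvP (addvSl _ _)); rewrite lieDr lieZr memvD ?memvZ ?nv//.
    exact: nV.
  exists m.+1 => k kn kV; rewrite iterSr; apply: Vm.
    by apply/lie_prodP => x y _ _; exact: gn.
  apply/lie_prodP => x y /(subvP kn) xn /(subvP kV).
  move=> /memv_addP[w wV [_ /vlineP[a ->] ->]].
  by rewrite lieDr lieZr memvD ?memvZ ?nv// nV.
have [V [dV _ [m Vm]]] := flag _ (leqnn _); exists m.+1.
have dE j : derived_series g j.+1 =
    iter j (fun k => lie_prod k k) (derived_series g 1).
  by elim: j => //= j <-.
rewrite dE; apply: Vm; first by apply/lie_prodP => x y _ _; exact: gn.
by have /eqP -> : (V == fullv)%VS; rewrite ?subvf// eqEdim subvf.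
Qed.

End Engel.

(** * The Killing form *)

Lemma char_poly_simmx (F : fieldType) n (A P : 'M[F]_n) :
  P \in unitmx -> char_poly (P *m A *m invmx P) = char_poly A.
Proof.
move=> uP; rewrite /char_poly /char_poly_mx.
have PV : map_mx polyC P *m map_mx polyC (invmx P) = 1%:M.
  by rewrite -map_mxM mulmxV// map_mx1.
have -> : 'X%:M - map_mx polyC (P *m A *m invmx P) =
    map_mx polyC P *m ('X%:M - map_mx polyC A) *m map_mx polyC (invmx P).
  by rewrite !map_mxM mulmxBr mulmxBl scalar_mxC -(mulmxA 'X%:M) PV mulmx1.
by rewrite !det_mulmx mulrAC -det_mulmx PV det1 mul1r.
Qed.

Lemma mxtrace_sqr_simmx (F : fieldType) n (A P : 'M[F]_n) : P \in unitmx ->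
  \tr (P *m A *m invmx P *m (P *m A *m invmx P)) = \tr (A *m A).
Proof.
move=> uP; have -> : P *m A *m invmx P *m (P *m A *m invmx P) =
    P *m (A *m A *m invmx P) by rewrite !mulmxA mulmxKV.
by rewrite mxtrace_mulC mulmxKV.
Qed.

Lemma mxtrace_sqr_trig (F : comPzRingType) n (T : 'M[F]_n) : is_trig_mx T ->
  \tr (T *m T) = \sum_i T i i ^+ 2.
Proof.
move=> /is_trig_mxP trT; apply: eq_bigr => i _; rewrite mxE (bigD1 i)//=.
rewrite big1 ?addr0// => j ji; have [ij|ij|/val_inj ij] := ltngtP i j.
- by rewrite trT ?mul0r.
- by rewrite [T j i]trT ?mulr0.
- by rewrite ij eqxx in ji.
Qed.

(** Schur triangularisation over the complex numbers puts the eigenvalues, real by hypothesis, on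
    the diagonal; both identities then descend along the injection of R into [R[i]]. *)
Lemma char_poly_real_spectrum (R : rcfType) n (A : 'M[R]_n) :
  (forall z, eigenvalue (map_mx (real_complex R) A) z ->
    exists r : R, z = r%:C%C) ->
  exists2 r : 'I_n -> R, char_poly A = \prod_i ('X - (r i)%:P) &
    \tr (A *m A) = \sum_i r i ^+ 2.
Proof.
case: n A => [|n] A realA.
  exists (fun=> 0); first by rewrite big_ord0 /char_poly det_mx00.
  by rewrite /mxtrace !big_ord0.
set AC := map_mx (real_complex R) A in realA.
have [P /unitarymx_unit uP trT] := spectral.Schur AC (ltn0Sn n).
have {trT} : is_trig_mx (conjmx P AC) := trT; rewrite conjumx//.
set T := P *m AC *m invmx P => trT.
have chT : char_poly AC = \prod_i ('X - (T i i)%:P).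
  by rewrite -(char_poly_simmx AC uP) char_poly_trig.
have /fin_all_exists[r rT] i : exists r : R, T i i = r%:C%C.
  apply: realA; rewrite eigenvalue_root_char chT (bigD1 i)//=.
  by rewrite rootM root_XsubC eqxx.
have rinj : injective (real_complex R) := @complexI R.
exists r.
  apply: (map_poly_inj (real_complex R)); rewrite map_char_poly -/AC chT.
  rewrite rmorph_prod; apply: eq_bigr => i _.
  by rewrite rmorphB/= map_polyX map_polyC/= rT.
apply: rinj; rewrite -trace_map_mx map_mxM -/AC rmorph_sum/=.
rewrite -(mxtrace_sqr_simmx AC uP) -/T mxtrace_sqr_trig//.
apply: eq_bigr => i _.
by rewrite rT rmorphXn.
Qed.

(** Applying the linear factors one after the other allows induction on the list of roots, and
    carries over to [lie x] without polynomials in endomorphisms. *)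
Lemma Cayley_Hamilton_split (F : fieldType) n (A : 'M[F]_n) (r : 'I_n -> F) v :
  char_poly A = \prod_i ('X - (r i)%:P) ->
  foldl (fun v a => v *m A - a *: v) v (codom r) = 0 :> 'rV_n.
Proof.
case: n A r v => [|n] A r v chA; first exact: thinmx0.
have {chA} : horner_mx A (\prod_(a <- codom r) ('X - a%:P)) = 0.
  by rewrite big_image/= -chA Cayley_Hamilton.
suff -> : foldl (fun v a => v *m A - a *: v) v (codom r) =
    v *m horner_mx A (\prod_(a <- codom r) ('X - a%:P)).
  by move=> ->; rewrite mulmx0.
elim: (codom r) v => [|a s IH] v /=; first by rewrite big_nil rmorph1 mulmx1.
rewrite IH big_cons rmorphM/= rmorphB/= horner_mx_X horner_mx_C.
by rewrite mulmxA mulmxBr mul_mx_scalar.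
Qed.

Section Killing.
Variables (R : realType) (g : finLieAlgType R).
Implicit Types x y z : g.

Let e := vbasis {:g}.
Let eB : basis_of {:g} e := vbasisP fullv.

Definition ad_mx x := mxof e e (ad x).

Lemma ad_mxE x y : rVof e y *m ad_mx x = rVof e (lie x y).
Proof. by rewrite -rVof_app// adE. Qed.

Lemma ad_mx_linear : linear ad_mx.
Proof.
move=> a x y; apply/row_matrixP => i; rewrite !rowE.
rewrite -(vecofK eB (delta_mx 0 i)) mulmxDr -scalemxAr !ad_mxE.
by rewrite lieDl lieZl linearP.
Qed.

HB.instance Definition _ :=
  GRing.isLinear.Build R g _ *:%R ad_mx ad_mx_linear.

(** Matrices act on row vectors, so the left factor acts first and the commutator is reversed. *)
Lemma ad_mx_lie x y : ad_mx (lie x y) = ad_mx y *m ad_mx x - ad_mx x *m ad_mx y.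
Proof.
apply/row_matrixP => i; rewrite !rowE.
rewrite -(vecofK eB (delta_mx 0 i)) mulmxBr !mulmxA !ad_mxE -linearB/=.
by rewrite lie_leibniz addrK.
Qed.

Definition killing x y := \tr (ad_mx x *m ad_mx y).

Lemma killingC x y : killing x y = killing y x.
Proof. exact: mxtrace_mulC. Qed.

Lemma killingDl x y z : killing (x + y) z = killing x z + killing y z.
Proof. by rewrite /killing linearD mulmxDl linearD. Qed.

Lemma killingZl a x z : killing (a *: x) z = a * killing x z.
Proof. by rewrite /killing linearZ/= -scalemxAl linearZ. Qed.

Lemma killingNl x z : killing (- x) z = - killing x z.
Proof. by rewrite -scaleN1r killingZl mulN1r. Qed.

Lemma killing0l z : killing 0 z = 0.
Proof. by rewrite -(scale0r 0) killingZl mul0r. Qed.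

Lemma killing_lie x y z : killing (lie x y) z = killing x (lie y z).
Proof.
rewrite /killing !ad_mx_lie mulmxBl mulmxBr !linearB/=.
congr (_ - _); last by rewrite mulmxA.
by rewrite -mulmxA mxtrace_mulC mulmxA.
Qed.

Hypothesis real_ad : forall x (z : R[i]),
  ad_eigenvalue x z -> exists r : R, z = r%:C%C.

Lemma ad_mx_char_poly x :
  exists2 r : 'I_(\dim {:g}) -> R,
    char_poly (ad_mx x) = \prod_i ('X - (r i)%:P) &
    killing x x = \sum_i r i ^+ 2.
Proof. by apply: char_poly_real_spectrum => z; exact: (@real_ad x z). Qed.

Lemma killing_ge0 x : 0 <= killing x x.
Proof.
by have [r _ ->] := ad_mx_char_poly x; apply: sumr_ge0 => i _; exact: sqr_ge0.
Qed.

(** Otherwise the form at a x + y would be affine in a with nonzero slope, hence somewhere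
    negative. *)
Lemma killing_isotropic x y : killing x x = 0 -> killing x y = 0.
Proof.
move=> xx; apply/eqP; apply/negPn/negP => xy0.
(* Chosen to make the form at a x + y equal to -1. *)
pose a := - (killing y y + 1) / (2 * killing x y).
have := killing_ge0 (a *: x + y).
have -> : killing (a *: x + y) (a *: x + y) =
    2 * (a * killing x y) + killing y y.
  rewrite killingDl killingZl !(killingC _ (_ + _)) !killingDl !killingZl xx.
  by rewrite (killingC y x); ring.
have -> : a * killing x y = - (killing y y + 1) / 2 by rewrite /a; field.
lra.
Qed.

Lemma ad_Cayley_Hamilton x y (r : 'I_(\dim {:g}) -> R) :
  char_poly (ad_mx x) = \prod_i ('X - (r i)%:P) ->
  foldl (fun v a => lie x v - a *: v) y (codom r) = 0.
Proof.
move=> /(Cayley_Hamilton_split (rVof e y)) chr0; apply/eqP.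
rewrite -(rVof_eq0 eB) -chr0; apply/eqP.
elim: (codom r) y {chr0} => //= a s IH y.
by rewrite IH linearB linearZ/= ad_mxE.
Qed.

(** The squares of the real eigenvalues of ad x sum to 0, so all of them vanish and Cayley-Hamilton
    says that a power of ad x is 0. *)
Lemma killing_isotropic_ad_nilpotent x : killing x x = 0 -> ad_nilpotent x.
Proof.
have [r chr ->] := ad_mx_char_poly x => /eqP.
rewrite psumr_eq0 => [/allP r0|i _]; last exact: sqr_ge0.
exists (size (codom r)) => y; rewrite -[RHS](ad_Cayley_Hamilton y chr).
have {r0} : {in codom r, forall a, a = 0}.
  move=> _ /codomP[i ->]; apply/eqP; rewrite -sqrf_eq0.
  by apply: r0; rewrite mem_index_enum.
elim: (codom r) y => //= a s IH y s0; rewrite (s0 a (mem_head _ _)).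
rewrite scale0r subr0 -IH -?iterSr// => b bs.
by apply: s0; rewrite inE bs orbT.
Qed.

(* ad x is skew for the positive semidefinite Killing form and has real
   spectrum, so it vanishes modulo the radical. *)
Lemma killing_lie_isotropic x y : killing (lie x y) (lie x y) = 0.
Proof.
have [r /(ad_Cayley_Hamilton y) + _] := ad_mx_char_poly x.
(* The factors ad x - a are peeled off one by one: isotropy of [x, w] for w = [x, y] - a y must give
   that of [x, y]. *)
elim: (codom r) y => /= [y ->|a s IH y /IH].
  by rewrite lie0r killing0l.
set w := lie x y - a *: y => xw.
have {xw} xw z : killing (lie x w) z = 0 by exact: killing_isotropic.
have skew u : killing (lie x u) u = 0.
  by rewrite killing_lie liexx killingC killing0l.
have xwE : lie x w = lie x (lie x y) - a *: lie x y.
  by rewrite lieDr lieNr lieZr.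
(* If a = 0, invariance moves one ad x across the form and produces [x, w], which is in the radical.
   Otherwise pairing [x, w] with [x, y] leaves only -a times the wanted value, by skewness. *)
have [a0|a0] := eqVneq a 0.
  have xxy : lie x (lie x y) = lie x w by rewrite xwE a0 scale0r subr0.
  by rewrite {1}lieC killingNl killing_lie xxy killingC xw oppr0.
have := xw (lie x y); rewrite xwE killingDl killingNl killingZl skew add0r.
by move/eqP; rewrite oppr_eq0 mulf_eq0 (negPf a0) => /eqP.
Qed.

End Killing.

Lemma solvable_of_real_ad (R : realType) (g : finLieAlgType R) :
  (forall (x : g) z, ad_eigenvalue x z -> exists r : R, z = r%:C%C) ->
  lie_solvable g.
Proof.
move=> real_ad.
apply: (@solvable_of_ad_nilpotent_derived _ _ (lie_prod fullv fullv)).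
  move=> x xgg; apply: (killing_isotropic_ad_nilpotent real_ad).
  (* An element of [g, g] is a combination of brackets, each isotropic and hence in the radical. *)
  rewrite {1}(@coord_span _ _ _ (in_tuple _) _ xgg).
  apply: (big_ind (fun z => killing z x = 0)); first exact: killing0l.
    by move=> u v ux vx; rewrite killingDl ux vx addr0.
  move=> i _.
  have /allpairsP[[u v] [_ _]] := mem_nth 0 (ltn_ord i); rewrite killingZl.
  move=> uvE; rewrite [X in killing X _]uvE.
  by rewrite killing_isotropic ?mulr0// killing_lie_isotropic.
by move=> x y; have /lie_prodP -> := subvv (lie_prod {:g} {:g}); rewrite ?memvf.
Qed.

(** * Exponentials in the complexification *)

(** Both sides run over the pairs with i + j < M, on the left by antidiagonals. *)
Lemma triangular_sum (V : nmodType) (T : nat -> nat -> V) M :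
  \sum_(n < M) \sum_(i < n.+1) T i (n - i)%N =
  \sum_(i < M) \sum_(0 <= j < M - i) T i j.
Proof.
elim: M => [|M IH]; first by rewrite !big_ord0.
rewrite big_ord_recr/= IH [RHS]big_ord_recr/= subSnn big_nat1.
rewrite [X in _ + X]big_ord_recr/= subnn addrA; congr (_ + _).
rewrite -big_split/=; apply: eq_bigr => i _.
by rewrite subSn ?big_nat_recr// ltnW.
Qed.

Lemma square_sumB_triangular (V : zmodType) (T : nat -> nat -> V) M :
  \sum_(i < M) \sum_(j < M) T i j - \sum_(n < M) \sum_(i < n.+1) T i (n - i)%N =
  \sum_(i < M) \sum_(M - i <= j < M) T i j.
Proof.
rewrite triangular_sum -sumrB; apply: eq_bigr => i _.
rewrite -(big_mkord xpredT (T i)) (big_cat_nat (n := (M - i)%N))//=.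
  by rewrite addrAC subrr add0r.
exact: leq_subr.
Qed.

Lemma exp_coeffD (R : realType) (a b : R) n :
  \sum_(i < n.+1) exp_coeff a i * exp_coeff b (n - i)%N = exp_coeff (a + b) n.
Proof.
rewrite /exp_coeff/= addrC exprDn mulr_suml; apply: eq_bigr => i _.
have le_in : (i <= n)%N by rewrite -ltnS.
have nz k : (k`!%:R : R) != 0 by rewrite pnatr_eq0 -lt0n fact_gt0.
rewrite -(bin_fact le_in) !natrM -[X in _ = X / _]mulr_natr; field.
by rewrite !nz pnatr_eq0 -lt0n bin_gt0.
Qed.

Lemma amul_suml (K : pzRingType) (A : unitalAlgType K) I (s : seq I)
    (F : I -> A) (a : A) :
  (\sum_(i <- s) F i) ** a = \sum_(i <- s) F i ** a.
Proof.
apply: (big_morph (amul^~ a)) => [x y|]; first exact: amulDl.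
by rewrite -(scale0r (0 : A)) amulZl !scale0r.
Qed.

Lemma amul_sumr (K : pzRingType) (A : unitalAlgType K) I (s : seq I)
    (F : I -> A) (a : A) :
  a ** (\sum_(i <- s) F i) = \sum_(i <- s) a ** F i.
Proof.
apply: (big_morph (amul a)) => [x y|]; first exact: amulDr.
by rewrite -(scale0r (0 : A)) amulZr !scale0r.
Qed.

Section Exponential.
Variables (R : realType) (A : banachAlgType R).
Local Notation AC := (complexification A).
Local Notation N := (@cplx_norm R A).
Implicit Types (u w x y : AC).

Definition aexp_coeff x n : AC := (n`!%:R)^-1 *: apow x n.

Lemma cplx_norm_ge0 x : 0 <= N x.
Proof. exact: le_trans (cplx_norm1_ge0 x) (cplx_norm1_le x). Qed.

Lemma normc_real (r : R) : complex.ComplexField.Normc.normc r%:C%C = `|r|.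
Proof. by rewrite /= expr0n addr0 sqrtr_sqr. Qed.

Lemma cplx_norm0 : N 0 = 0.
Proof.
rewrite -(scale0r (0 : AC)) cplx_normZ.
by rewrite complex.ComplexField.Normc.normc0 mul0r.
Qed.

Lemma cplx_normN x : N (- x) = N x.
Proof.
by have [] := normrN x.
Qed.

Lemma cplx_norm_sum I (s : seq I) (F : I -> AC) :
  N (\sum_(i <- s) F i) <= \sum_(i <- s) N (F i).
Proof.
elim/big_ind2 : _ => //; first by rewrite cplx_norm0.
by move=> x a y b xa yb; apply: le_trans (cplx_normD _ _) _; exact: lerD.
Qed.

(** The factor [N aone] remains because the norm of the identity is not assumed to be 1. *)
Lemma cplx_norm_apow x n : N (apow x n) <= N aone * N x ^+ n.
Proof.
elim: n => [|n IH]; first by rewrite mulr1.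
apply: le_trans (cplx_normM _ _) _; rewrite exprS mulrCA.
by apply: ler_wpM2l IH; exact: cplx_norm_ge0.
Qed.

Lemma cplx_norm_aexp_coeff x n :
  N (aexp_coeff x n) <= N aone * exp_coeff (N x) n.
Proof.
have -> : aexp_coeff x n = (n`!%:R^-1)%:C%C *: apow x n.
  rewrite /aexp_coeff rmorphV ?unitfE ?pnatr_eq0 -?lt0n ?fact_gt0//.
  by rewrite rmorph_nat.
rewrite cplx_normZ normc_real ger0_norm ?invr_ge0// /exp_coeff/= mulrA mulrC.
by rewrite ler_wpM2r ?invr_ge0// cplx_norm_apow.
Qed.

(** Completeness and comparison with the real exponential series at [N x]. *)
Lemma aexp_cvg x : series (aexp_coeff x) @ \oo --> aexp x.
Proof.
suff : cvgn (series (aexp_coeff x)) by [].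
apply/cauchy_cvgP/cauchy_seriesP => eps; rewrite ltcE/= => /andP[/eqP Ime e0].
have -> : eps = (complex.Re eps)%:C%C by case: eps Ime {e0} => r i /= ->.
set e := complex.Re eps in e0 *.
(* The added 1 keeps the divisor positive: [N aone] is 0 in the zero algebra. *)
have c0 : 0 < N aone + 1 :> R by rewrite ltr_wpDl// cplx_norm_ge0.
have /cauchy_cvgP/cauchy_seriesP/(_ (e / (N aone + 1))) :=
  @is_cvg_series_exp_coeff R (N x).
move=> /(_ (divr_gt0 e0 c0)); apply: filterS => -[m n] /=.
rewrite ger0_norm; last first.
  by apply: sumr_ge0 => i _; apply: exp_coeff_ge0; exact: cplx_norm_ge0.
rewrite ltr_pdivlMr// => lt_e; rewrite cplx_normE ltcR.
apply: le_lt_trans (cplx_norm_sum _ _) _; apply: le_lt_trans lt_e.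
rewrite mulr_suml; apply: ler_sum => i _.
apply: le_trans (cplx_norm_aexp_coeff _ _) _; rewrite mulrC.
by apply: ler_wpM2l; rewrite ?lerDl// exp_coeff_ge0// cplx_norm_ge0.
Qed.

Lemma near_cplx_norm_series x :
  \forall n \near \oo, N (series (aexp_coeff x) n) <= N (aexp x) + 1.
Proof.
have /cvgrPdist_lt/(_ 1 ltr01) := @aexp_cvg x.
apply: filterS => n; rewrite cplx_normE ltcR => /ltW le1.
rewrite -[series _ n](subKr (aexp x)); apply: le_trans (cplx_normD _ _) _.
by rewrite cplx_normN lerD2l.
Qed.

Lemma apowSr x n : apow x n.+1 = apow x n ** x.
Proof. by elim: n => [|n IH]; rewrite /= ?amul1l ?amul1r// -amulA -IH. Qed.

Lemma aexp_coeffSl x n : n.+1%:R *: aexp_coeff x n.+1 = x ** aexp_coeff x n.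
Proof.
rewrite /aexp_coeff amulZr scalerA factS natrM invfM mulrA.
by rewrite divff ?mul1r// pnatr_eq0.
Qed.

Lemma aexp_coeffSr x n : n.+1%:R *: aexp_coeff x n.+1 = aexp_coeff x n ** x.
Proof.
rewrite /aexp_coeff amulZl -apowSr scalerA factS natrM invfM mulrA.
by rewrite divff ?mul1r// pnatr_eq0.
Qed.

(* The n-th coefficient of s |-> exp(s u) y exp(s w). *)
Lemma aexp_coeff_conj u w y (c : R[i]) n : u ** y + y ** w = c *: y ->
  \sum_(i < n.+1) aexp_coeff u i ** y ** aexp_coeff w (n - i)%N =
  (c ^+ n / n`!%:R) *: y.
Proof.
move=> uyw; elim: n => [|n IH].
  rewrite big_ord1 /aexp_coeff fact0 invr1 !scale1r.
  by rewrite amul1l amul1r expr0 mulr1 scale1r.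
have n0 : n.+1%:R != 0 :> R[i] by rewrite pnatr_eq0.
apply: (can_inj (scalerK n0)); rewrite scalerA.
have -> : n.+1%:R * (c ^+ n.+1 / n.+1`!%:R) = c ^+ n / n`!%:R * c.
  rewrite factS natrM exprS; move: (n.+1%:R) n0 => a a0; field.
  by rewrite a0 pnatr_eq0 -lt0n fact_gt0.
rewrite -scalerA -uyw scalerDr -amulZr -amulZl -IH.
rewrite amul_suml amul_sumr.
(* The product rule on coefficients: the weight n + 1 is split as i + (n + 1 - i), and each part
   lowers the degree of one exponential. *)
transitivity (\sum_(i < n.+2) (i%:R : R[i]) *:
      (aexp_coeff u i ** y ** aexp_coeff w (n.+1 - i)%N) +
    \sum_(i < n.+2) ((n.+1 - i)%:R : R[i]) *:
      (aexp_coeff u i ** y ** aexp_coeff w (n.+1 - i)%N)).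
  rewrite scaler_sumr -big_split; apply: eq_bigr => i _ /=.
  by rewrite -scalerDl -natrD subnKC// -ltnS.
congr (_ + _).
  rewrite big_ord_recl scale0r add0r; apply: eq_bigr => i _.
  by rewrite lift0 subSS -!amulZl aexp_coeffSl !amulA.
rewrite big_ord_recr/= subnn scale0r addr0; apply: eq_bigr => i _.
have le_in : (i <= n)%N by rewrite -ltnS.
rewrite (subSn le_in) -amulZr.
rewrite aexp_coeffSr amulA.
by [].
Qed.

(* The terms of the square partial sum outside the Cauchy triangle are dominated
   by those of the real series at N u and N w, whose remainder tends to 0. *)
Lemma cplx_norm_conj_remainder u w y (c : R) M :
  u ** y + y ** w = c%:C%C *: y ->
  `|series (exp_coeff c) M| * N y <=
    N (series (aexp_coeff u) M) * N y * N (series (aexp_coeff w) M) +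
    N aone * N y * N aone *
    (series (exp_coeff (N u)) M * series (exp_coeff (N w)) M -
      series (exp_coeff (N u + N w)) M).
Proof.
move=> uyw.
pose T i j := aexp_coeff u i ** y ** aexp_coeff w j.
pose t i j := exp_coeff (N u) i * exp_coeff (N w) j.
have cE : (series (exp_coeff c) M)%:C%C *: y =
    \sum_(n < M) \sum_(i < n.+1) T i (n - i)%N.
  rewrite /series/= big_mkord rmorph_sum scaler_suml; apply: eq_bigr => n _.
  rewrite (aexp_coeff_conj _ uyw) /exp_coeff/= rmorphM rmorphXn fmorphV.
  by rewrite rmorph_nat.
have sqE : series (aexp_coeff u) M ** y ** series (aexp_coeff w) M =
    \sum_(i < M) \sum_(j < M) T i j.
  rewrite /series/= !big_mkord.
  rewrite !amul_suml; apply: eq_bigr => i _; exact: amul_sumr.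
have tE : series (exp_coeff (N u)) M * series (exp_coeff (N w)) M -
    series (exp_coeff (N u + N w)) M =
    \sum_(i < M) \sum_(M - i <= j < M) t i j.
  rewrite -square_sumB_triangular /series/= !big_mkord mulr_suml.
  congr (_ - _); apply: eq_bigr => i _; first by rewrite mulr_sumr.
  by rewrite exp_coeffD.
have <- : N ((series (exp_coeff c) M)%:C%C *: y) =
  `|series (exp_coeff c) M| * N y by rewrite cplx_normZ normc_real.
rewrite cE -[X in N X](subKr (\sum_(i < M) \sum_(j < M) T i j)).
rewrite square_sumB_triangular -sqE tE.
apply: le_trans (cplx_normD _ _) _; rewrite cplx_normN lerD//.
  apply: le_trans (cplx_normM _ _) _.
  apply: ler_wpM2r; first exact: cplx_norm_ge0.
  exact: cplx_normM.
rewrite mulr_sumr; apply: le_trans (cplx_norm_sum _ _) _; apply: ler_sum => i _.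
rewrite mulr_sumr; apply: le_trans (cplx_norm_sum _ _) _; apply: ler_sum => j _.
apply: le_trans (cplx_normM _ _) _.
have -> : N aone * N y * N aone * t i j = N aone * exp_coeff (N u) i * N y *
  (N aone * exp_coeff (N w) j) by rewrite /t; ring.
apply: ler_pM; rewrite ?cplx_norm_ge0 ?cplx_norm_aexp_coeff//.
apply: le_trans (cplx_normM _ _) _.
apply: ler_wpM2r; first exact: cplx_norm_ge0.
exact: cplx_norm_aexp_coeff.
Qed.

(** Formally exp(u) y exp(w) = e^c y, and one takes norms and divides by [N y]. The estimate is made
    on partial sums and passed to the limit; the added 1s come from bounding those partial sums. *)
Lemma expR_le_conj u w y (c : R) : u ** y + y ** w = c%:C%C *: y -> y != 0 ->
  expR c <= (N (aexp u) + 1) * (N (aexp w) + 1).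
Proof.
move=> uyw y0.
have Ny : 0 < N y.
  rewrite lt_neqAle cplx_norm_ge0 andbT eq_sym.
  by apply: contra_neq y0; exact: cplx_norm_eq0.
rewrite -(ler_pM2r Ny).
set D := N aone * N y * N aone.
pose rem M := series (exp_coeff (N u)) M * series (exp_coeff (N w)) M -
  series (exp_coeff (N u + N w)) M.
have cvgE a : series (exp_coeff a) @ \oo --> (expR a : R).
  exact: is_cvg_series_exp_coeff.
have cvg_rem : (fun M => `|series (exp_coeff c) M| * N y - D * rem M) @ \oo -->
    expR c * N y.
  (* The limit of [rem] vanishes by the functional equation of the real exponential. *)
  have {1}-> : expR c * N y = `|expR c| * N y -
      D * (expR (N u) * expR (N w) - expR (N u + N w)).
    by rewrite expRD subrr mulr0 subr0 ger0_norm ?expR_ge0.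
  apply: cvgB.
    by apply: cvgM; [exact: cvg_norm|exact: cvg_cst].
  apply: cvgM; first exact: cvg_cst.
  by apply: cvgB => //; exact: cvgM.
apply: (cvgr_to_le cvg_rem).
have := near_cplx_norm_series w; apply: filterS2 (near_cplx_norm_series u).
move=> M leu lew; rewrite lerBlDr.
apply: le_trans (cplx_norm_conj_remainder M uyw) _.
rewrite -/D -/(rem M) lerD2r mulrAC ler_wpM2r ?cplx_norm_ge0//.
exact: (ler_pM (cplx_norm_ge0 _) (cplx_norm_ge0 _) leu lew).
Qed.

End Exponential.

(** * Polynomial growth *)

Lemma powR_le_expn (R : realType) (a x : R) n :
  1 <= x -> a <= n%:R -> x `^ a <= x ^+ n.
Proof.
move=> x1 an; rewrite -powR_mulrn; last exact: le_trans x1.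
exact: ler_powR.
Qed.

Lemma expn_le_expR (R : realType) (x : R) n :
  0 <= x -> (1 + x) ^+ n <= expR (x *+ n).
Proof.
move=> x0; rewrite -mulr_natl expRM_natl.
rewrite lerXn2r ?nnegrE ?expR_ge0 ?expR_ge1Dx//.
by rewrite addr_ge0.
Qed.

Lemma expR_superpolynomial (R : realType) (q C : R) n : 0 < q ->
  exists2 t, 0 <= t & C * (1 + t) ^+ n < expR (q * t).
Proof.
(* From c <= 1 follows c (1 + t) <= 1 + c t, and from c (n + 1) <= q follows (1 + c t)^(n + 1) <=
   e^(q t): one power of 1 + t is gained. *)
move=> q0; pose c := Num.min 1 (q / n.+1%:R).
have c0 : 0 < c by rewrite lt_min ltr01 divr_gt0.
have c1 : c <= 1 by rewrite ge_min lexx.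
have cq : c * n.+1%:R <= q by rewrite -ler_pdivlMr// ge_min lexx orbT.
(* With this t, c^(n + 1) (1 + t) = c^(n + 1) + |C| exceeds C. *)
exists (`|C| / c ^+ n.+1); first by rewrite divr_ge0// exprn_ge0// ltW.
set t := _ / _; have t0 : 0 <= t by rewrite divr_ge0// exprn_ge0// ltW.
have ltC : C < c ^+ n.+1 * (1 + t).
  rewrite mulrDr mulr1 /t mulrCA mulfV ?mulr1 ?expf_neq0 ?gt_eqF//.
  by rewrite ltr_pwDl ?exprn_gt0// ler_norm.
have tn : 0 < (1 + t) ^+ n by rewrite exprn_gt0// ltr_pwDl.
apply: (@lt_le_trans _ _ ((c * (1 + t)) ^+ n.+1)).
  by rewrite exprMn [(1 + t) ^+ n.+1]exprS mulrA ltr_pM2r.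
apply: (@le_trans _ _ ((1 + c * t) ^+ n.+1)).
  have c0' := ltW c0.
  apply: lerXn2r; last by rewrite mulrDr mulr1 lerD2r.
    by rewrite nnegrE mulr_ge0 ?addr_ge0.
  by rewrite nnegrE; apply: addr_ge0 => //; exact: mulr_ge0.
apply: le_trans (expn_le_expR _ _) _; first by rewrite mulr_ge0// ltW.
by rewrite ler_expR -mulr_natr mulrAC ler_wpM2r.
Qed.

Lemma expR_not_poly_bound (R : realType) (q K1 a1 K2 a2 : R) :
  0 < q -> 0 < K1 -> 0 < K2 ->
  ~ forall t : R, 0 <= t ->
    expR (q * t) <= (K1 * (1 + t) `^ a1 + 1) * (K2 * (1 + t) `^ a2 + 1).
Proof.
move=> q0 K10 K20 bound.
have poly (K a : R) : 0 < K -> exists n, forall t : R, 0 <= t ->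
    0 <= K * (1 + t) `^ a + 1 <= (K + 1) * (1 + t) ^+ n.
  (* The real exponent is rounded up to a natural number, and the added 1 is absorbed since 1 + t >=
     1. *)
  move=> K0; exists (Num.trunc a).+1 => t t0.
  have t1 : 1 <= 1 + t by rewrite lerDl.
  rewrite addr_ge0 ?mulr_ge0 ?powR_ge0 ?(ltW K0)//= mulrDl mul1r.
  rewrite lerD ?exprn_ege1// ler_wpM2l ?(ltW K0)// powR_le_expn//.
  by apply: ltW; exact: truncnS_gt.
have [n1 le1] := poly K1 a1 K10; have [n2 le2] := poly K2 a2 K20.
have [t t0] := expR_superpolynomial ((K1 + 1) * (K2 + 1)) (n1 + n2) q0.
apply/negP; rewrite -leNgt; apply: le_trans (bound t t0) _.
have /andP[ge1 {}le1] := le1 t t0; have /andP[ge2 {}le2] := le2 t t0.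
by rewrite exprD mulrACA ler_pM.
Qed.

(** The two equations are the real and imaginary parts of [b, y] = (p + iq) y for y = y1 + i y2. *)
Lemma commutator_real_eigenvalue (R : realType) (A : banachAlgType R)
    (b y1 y2 : A) (p q : R) :
  of_poly_growth A -> q != 0 ->
  commutator b y1 = p *: y1 - q *: y2 ->
  commutator b y2 = p *: y2 + q *: y1 -> y1 = 0 /\ y2 = 0.
Proof.
move=> growth q0 by1 by2; pose y : complexification A := (y1, y2).
suff : y = 0 by case.
apply/eqP/negPn/negP => y0.
(* In the complexification [b, y] = (p + iq) y; replacing b by b + p on the
   right absorbs p, so that only real exponentials occur. *)
pose b' := b + p *: aone.
have [K1 [a1 [K10 _ le1]]] := growth b.
have [K2 [a2 [K20 _ le2]]] := growth b'.
apply: (@expR_not_poly_bound _ `|q| K1 a1 K2 a2); rewrite ?normr_gt0//.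
(* The sign makes -s q = |q| t, so that the real exponential grows with t. *)
move=> t t0; pose s := - Num.sg q * t.
have ns : `|s| = t by rewrite normrM normrN normr_sg q0 mul1r ger0_norm.
pose u : complexification A := (s *i)%C *: ((b, 0) : complexification A).
pose w : complexification A := ((- s) *i)%C *: ((b', 0) : complexification A).
have {}le1 : cplx_norm (aexp u) <= K1 * (1 + t) `^ a1.
  by rewrite -ns -lecR; exact: le1 s.
have {}le2 : cplx_norm (aexp w) <= K2 * (1 + t) `^ a2.
  by rewrite -ns -(normrN s) -lecR; exact: le2 (- s).
have yb : ((b, 0) : complexification A) ** y - y ** (b', 0) = (q *i)%C *: y.
  apply: cplx_ext; rewrite /= !(amul0l, amul0r) ?subr0 ?add0r ?addr0.
    rewrite scale0r sub0r /b' amulDr amulZr amul1r opprD addrA.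
    have -> : b ** y1 - y1 ** b = p *: y1 - q *: y2 by [].
    by rewrite addrAC subrr add0r.
  rewrite scale0r add0r /b' amulDr amulZr amul1r opprD addrA.
  have -> : b ** y2 - y2 ** b = p *: y2 + q *: y1 by [].
  by rewrite addrAC subrr add0r.
apply: (@le_trans _ _ ((cplx_norm (aexp u) + 1) * (cplx_norm (aexp w) + 1))).
  apply: (expR_le_conj (y := y)) => //.
  rewrite /u /w amulZl amulZr.
  have -> : ((- s) *i)%C = - (s *i)%C.
    by apply/eqP; rewrite eq_complex/= oppr0 !eqxx.
  rewrite scaleNr -scalerBr yb scalerA; congr (_ *: _).
  apply/eqP; rewrite eq_complex/= !mul0r mulr0 add0r addr0 eqxx andbT.
  by rewrite /s !mulNr opprK mulrAC -normrEsg.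
by apply: ler_pM; rewrite ?lerD2r// addr_ge0// cplx_norm_ge0.
Qed.

(** * Embedding into one Banach algebra *)

(** A complex eigenvector of the real matrix of ad x is split into real and imaginary parts, which
    are vectors of g itself. *)
Lemma ad_eigenvalue_pair (R : realType) (g : finLieAlgType R)
    (x : g) (z : R[i]) :
  ad_eigenvalue x z -> exists y1 y2 : g,
    [/\ ~ (y1 = 0 /\ y2 = 0),
      lie x y1 = complex.Re z *: y1 - complex.Im z *: y2 &
      lie x y2 = complex.Re z *: y2 + complex.Im z *: y1].
Proof.
move=> /eigenvalueP[v vz v0].
have eB : basis_of {:g} (vbasis {:g}) := vbasisP fullv.
pose re := map_mx (@complex.Re R) v; pose im := map_mx (@complex.Im R) v.
have vM j : \sum_k v 0 k * (ad_mx x k j)%:C%C = z * v 0 j.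
  have := congr1 (fun u : 'rV_ _ => u 0 j) vz; rewrite !mxE => <-.
  by apply: eq_bigr => k _; rewrite !mxE.
exists (vecof (vbasis {:g}) re), (vecof (vbasis {:g}) im); split.
- move=> [/eqP + /eqP]; rewrite !vecof_eq0// => /eqP re0 /eqP im0.
  case/eqP: v0; apply/rowP => j; rewrite mxE; apply/eqP.
  move/rowP/(_ j): re0; move/rowP/(_ j): im0; rewrite !mxE => im0 re0.
  by rewrite eq_complex re0 im0 eqxx.
- apply: (can_inj (rVofK eB)); rewrite -ad_mxE linearB !linearZ/= !vecofK//.
  apply/rowP => j; rewrite !mxE.
  transitivity (complex.Re (z * v 0 j)).
    rewrite -vM raddf_sum; apply: eq_bigr => k _; rewrite mxE.
    by case: (v 0 k) => c d /=; rewrite mulr0 subr0.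
  by case: (z) (v 0 j) => c d [c' d'] /=; rewrite mulrN.
apply: (can_inj (rVofK eB)); rewrite -ad_mxE linearD !linearZ/= !vecofK//.
apply/rowP => j; rewrite !mxE.
transitivity (complex.Im (z * v 0 j)).
  rewrite -vM raddf_sum; apply: eq_bigr => k _; rewrite mxE.
  by case: (v 0 k) => c d /=; rewrite mulr0 add0r.
by case: (z) (v 0 j) => c d [c' d'].
Qed.

(** Kernels shrink along [le]. By induction on a spanning list: if f i is injective on the span of
    X, its kernel on the span of v :: X is at most a line <e>; some f j does not kill e, and an
    index above i and j serves. *)
Lemma directed_separating_injective (K : fieldType) (V : vectType K) (I : Type)
    (le : I -> I -> Prop) (W : I -> lmodType K)
    (f : forall i, {linear V -> W i}) :
  inhabited I ->
  (forall i j, exists k, le i k /\ le j k) ->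
  (forall i j x, le i j -> f j x = 0 -> f i x = 0) ->
  (forall x, (forall i, f i x = 0) -> x = 0) ->
  exists i, forall x, f i x = 0 -> x = 0.
Proof.
move=> [i0] dir mono sep.
suff [i fi] : exists i, forall x, x \in <<vbasis {:V}>>%VS ->
    f i x = 0 -> x = 0.
  by exists i => x; apply: fi; rewrite (span_basis (vbasisP _)) memvf.
elim: (tval (vbasis {:V})) => [|v X [i fi]].
  by exists i0 => x; rewrite span_nil memv0 => /eqP.
have [ker0|/existsNP[e]] := pselect (forall x, x \in <<v :: X>>%VS ->
  f i x = 0 -> x = 0); first by exists i.
move=> /not_implyP[eX /not_implyP[fe e0]].
have [j fje] : exists j, f j e <> 0 by apply/existsNP => /sep.
have [k [ik jk]] := dir i j.
have fke : f k e <> 0 by move=> /(mono _ _ _ jk).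
move: eX; rewrite span_cons => /memv_addP[_ /vlineP[c ->] [w wX eE]].
have c0 : c != 0.
  by apply/eqP => c0; apply: e0; apply: fi fe; rewrite eE c0 scale0r add0r.
exists k => x /memv_addP[_ /vlineP[d ->] [w' w'X xE]] fkx.
have fix0 := mono _ _ _ ik fkx.
(* The multiple of e cancels the coefficient of x at v, leaving a vector of the span of X killed by
   f i. *)
have xe : x - (d / c) *: e = 0.
  apply: fi; last by rewrite linearB linearZ/= fe scaler0 fix0 subr0.
  have -> : x - (d / c) *: e = w' - (d / c) *: w.
    by rewrite xE eE scalerDr scalerA divfK// opprD addrACA subrr add0r.
  by rewrite memvB ?memvZ.
move/eqP: xe; rewrite subr_eq0 => /eqP xe; move: fkx; rewrite xe linearZ/=.
by move/eqP; rewrite scaler_eq0 => /orP[/eqP ->|/eqP //]; rewrite scale0r.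
Qed.

Theorem corollary4p2 (R : realType) (g : finLieAlgType R)
    (S : projective_system R)
    (S_growth : forall i : ps_index S, of_poly_growth (ps_obj i))
    (B : topUnitalAlgType R) (p : forall i : ps_index S, B -> ps_obj i)
    (B_lim : is_projective_limit p)
    (gamma : g -> B) (gamma_hom : lie_hom gamma)
    (gamma_inj : injective gamma) :
  triangular g.
Proof.
have [gamma_lin gamma_lie] := gamma_hom.
have f_lin i : linear (p i \o gamma).
  have [p_lin _ _] := pl_hom B_lim i.
  by move=> a x y /=; rewrite gamma_lin p_lin.
pose f i : {linear g -> ps_obj i} :=
  HB.pack (p i \o gamma)
    (GRing.isLinear.Build _ _ _ _ (p i \o gamma) (f_lin i)).
have f_lie i x y : f i (lie x y) = commutator (f i x) (f i y).
  have [p_lin pM _] := pl_hom B_lim i.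
  rewrite /= gamma_lie /commutator -!pM -scaleN1r addrC p_lin scaleN1r.
  by rewrite addrC.
have [i fi] : exists i, forall x, f i x = 0 -> x = 0.
  apply: (@directed_separating_injective _ _ _ (@ps_le _ S)).
  - exact: ps_inhabited.
  - exact: ps_le_directed.
  - move=> i j x ij /= fjx; rewrite -(pl_compat B_lim ij) fjx.
    have [lin _ _] := ps_map_hom ij; have := lin (-1) 0 0.
    by rewrite scaleN1r oppr0 addr0 => ->; rewrite scaleN1r addNr.
  (* [gamma x] and [gamma 0] project to the same thread, so uniqueness in the projective limit
     identifies them. *)
  - move=> x fx0; apply: gamma_inj.
    have [|b [_ uniq_b]] := pl_thread B_lim (x := fun i => p i (gamma 0)).
      by move=> i j ij; exact: pl_compat.
    rewrite -(uniq_b (gamma 0))//; apply: esym; apply: uniq_b => i.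
    by have := fx0 i; have := linear0 (f i); rewrite /= => -> ->.
have real_ad (x : g) (z : R[i]) : ad_eigenvalue x z -> exists r : R, z = r%:C%C.
  move=> /ad_eigenvalue_pair[y1 [y2 [y0 xy1 xy2]]].
  exists (complex.Re z); apply/eqP; rewrite eq_complex/= eqxx/=.
  (* A nonreal eigenvalue is carried by [f i] into the Banach algebra, where both parts of the
     eigenvector must vanish; injectivity brings this back to g. *)
  apply/eqP/eqP/negPn/negP => z0; apply: y0.
  have [||y10 y20] := @commutator_real_eigenvalue _ _ (f i x) (f i y1) (f i y2)
    (complex.Re z) (complex.Im z) (S_growth i) z0.
  - by rewrite -f_lie xy1 linearB !linearZ.
  - by rewrite -f_lie xy2 linearD !linearZ.
  by split; exact: fi.
by split; first exact: solvable_of_real_ad.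
Qed.
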